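(* Let $R$ and $S$ be commutative rings with non-zero identity, $f:R\to S$ a surjective ring homomorphism, $J$ a maximal ideal of $S$, and $K$ an ideal of $S$. (1) If $\bar{K}^f$ is a $J$-ideal of $R\Join^f J$, then $K$ is a $J$-ideal of $S$. The converse is true if $f(J(R))=J(S)+J$ and $\mathrm{Ker}(f)\subseteq J(R)$. (2) If $\bar{K}^f$ is a weakly $J$-ideal of $R\Join^f J$, then $K$ is a weakly $J$-ideal of $S$ and, whenever $a,b\in R$ and $j,k\in J$ satisfy $f(a)+j\notin J(S)$, $f(b)+k\notin K$ and $(f(a)+j)(f(b)+k)=0$, then $ab=0$. The converse is true if $f(J(R))=J(S)+J$ and $\mathrm{Ker}(f)\subseteq J(R)$.
   Context: $J(A)$ denotes the Jacobson radical of a ring $A$. The terms ''$J$-ideal'' and ''weakly $J$-ideal'' refer to the Jacobson radical, not to the ideal named $J$: a proper ideal $I$ of a ring $A$ is a $J$-ideal if whenever $a,b\in A$ with $ab\in I$ and $a\notin J(A)$, then $b\in I$; it is a weakly $J$-ideal if whenever $a,b\in A$ with $0\neq ab\in I$ and $a\notin J(A)$, then $b\in I$. The amalgamation of $R$ and $S$ along $J$ with respect to $f$ is the subring $R\Join^f J=\{(r,f(r)+j): r\in R, j\in J\}$ of $R\times S$. For an ideal $K$ of $f(R)+J$ (here $f(R)+J=S$), $\bar{K}^f=\{(a,f(a)+j): a\in R,\ j\in J,\ f(a)+j\in K\}$, an ideal of $R\Join^f J$. *)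

(* Defs.v *)
From HB Require Import structures.
From mathcomp Require Import all_boot all_algebra.
From mathcomp Require Import boolp classical_sets.

Set Implicit Arguments.
Unset Strict Implicit.
Unset Printing Implicit Defensive.

Import GRing.Theory.

Local Open Scope classical_set_scope.
Local Open Scope ring_scope.

(* The library's [idealr] structure only covers proper ideals, whereas here an *)
(* ideal may be the whole ring; properness is always requested separately.     *)
Definition is_ideal (A : comNzRingType) (I : set A) : Prop :=
  I 0 /\ forall a u v, I u -> I v -> I (a * u + v).

(* Bundled so that the ring structure on [amalg f J] below can be inferred.    *)
Record ideal (A : comNzRingType) := Ideal {
  ideal_set :> set A;
  idealP : is_ideal ideal_set }.

Definition is_proper_ideal (A : comNzRingType) (I : set A) : Prop :=
  is_ideal I /\ I <> setT.

Lemma is_proper_idealE (A : comNzRingType) (I : set A) :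
  is_proper_ideal I <-> idealr_closed [in I].
Proof.
split=> [[[I0 IM] IT]|[/set_mem I0 /negP I1 IM]].
- split; [exact: mem_set | | by move=> a u v /set_mem ? /set_mem ?; apply/mem_set/IM].
  apply/negP => /set_mem I1; apply: IT; apply/seteqP; split=> // x _.
  by have := IM x _ _ I1 I0; rewrite mulr1 addr0.
- split; first by split=> // a u v Iu Iv; apply/set_mem/IM; exact: mem_set.
  by move=> IT; apply: I1; apply/mem_set; rewrite IT.
Qed.

Definition maximal_ideal (A : comNzRingType) (M : set A) : Prop :=
  is_proper_ideal M /\ forall I : set A, is_proper_ideal I -> M `<=` I -> I = M.

Definition jacobson (A : comNzRingType) : set A :=
  \bigcap_(M in @maximal_ideal A) M.
Arguments jacobson A _ : clear implicits.

(* The letter J in the next two names is that of the Jacobson radical. *)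
Definition J_ideal (A : comNzRingType) (I : set A) : Prop :=
  is_proper_ideal I /\
  forall a b : A, I (a * b) -> ~ jacobson A a -> I b.

Definition weakly_J_ideal (A : comNzRingType) (I : set A) : Prop :=
  is_proper_ideal I /\
  forall a b : A, a * b <> 0 -> I (a * b) -> ~ jacobson A a -> I b.

Section Amalgamation.
Variables (R S : comNzRingType) (f : {rmorphism R -> S}) (J : ideal S).

Definition amalg_set : set (R * S) :=
  [set (r, f r + j) | r in [set: R] & j in (J : set S)].

Definition amalg_pred : {pred R * S} := [in amalg_set].

Lemma amalg_subring_closed : subring_closed amalg_pred.
Proof.
have [J0 JM] := idealP J.
have JD u v : ideal_set J u -> ideal_set J v -> ideal_set J (u + v).
  by move=> Ju Jv; have := JM 1 u v Ju Jv; rewrite mul1r.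
have JMl a u : ideal_set J u -> ideal_set J (a * u).
  by move=> Ju; have := JM a u 0 Ju J0; rewrite addr0.
split.
- by apply/mem_set; exists 1 => //; exists 0 => //; rewrite addr0 rmorph1.
- move=> _ _ /set_mem[r _ [j Jj <-]] /set_mem[s _ [k Jk <-]].
  apply/mem_set; exists (r - s) => //; exists (j - k).
    by apply: JD => //; rewrite -mulN1r; exact: JMl.
  by rewrite rmorphB addrACA -opprD.
- move=> _ _ /set_mem[r _ [j Jj <-]] /set_mem[s _ [k Jk <-]].
  apply/mem_set; exists (r * s) => //; exists (f r * k + (f s + k) * j).
    by apply: JD; exact: JMl.
  congr pair; rewrite rmorphM [RHS]mulrDl mulrDr -addrA; congr (_ + (_ + _)).
  by rewrite mulrC.
Qed.

HB.instance Definition _ :=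
  GRing.isSubringClosed.Build (R * S)%type amalg_pred amalg_subring_closed.

Record amalg := Amalg {
  amalg_val :> R * S;
  amalg_valP : amalg_val \in amalg_pred }.

HB.instance Definition _ := [isSub for amalg_val].
HB.instance Definition _ := [Choice of amalg by <:].
HB.instance Definition _ := [SubChoice_isSubComNzRing of amalg by <:].

Definition ideal_bar (K : set S) : set amalg :=
  [set x | exists a j, [/\ (J : set S) j, K (f a + j) & amalg_val x = (a, f a + j)]].

End Amalgamation.

Arguments ideal_bar {R S} f J K _.

(* Main.v *)
Require Import Defs.
From HB Require Import structures.
From mathcomp Require Import all_boot all_algebra.
From mathcomp Require Import boolp classical_sets.

Set Implicit Arguments.
Unset Strict Implicit.
Unset Printing Implicit Defensive.

Import GRing.Theory.

Local Open Scope classical_set_scope.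
Local Open Scope ring_scope.

(** Both projections of [amalg f J] are surjective, onto [R] and onto
    [S = f R + J], and the product of their kernels is zero.  So a maximal ideal
    of [amalg f J], being prime, contains one of the two kernels and comes from
    a maximal ideal of [R] or of [S]: an element lies in the Jacobson radical iff
    both its coordinates do.  As [ideal_bar f J K] is the preimage of [K] under
    the second projection, it only remains to compare the conditions
    "[(a, f a + j)] is not in the radical" and "[f a + j] is not in the radical";
    they agree under the hypotheses of the converses, because [J] contains the
    Jacobson radical of [S], whence [f a] belongs to [J = f (jacobson R)] as soon
    as [f a + j] is in the radical. *)

Section IdealTheory.
Variable A : comNzRingType.
Implicit Types (I M : set A) (a u v : A).

Lemma idealMl I a u : is_ideal I -> I u -> I (a * u).
Proof. by move=> [I0 IM] Iu; have := IM a u 0 Iu I0; rewrite addr0. Qed.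

Lemma idealD I u v : is_ideal I -> I u -> I v -> I (u + v).
Proof. by move=> [_ IM] Iu Iv; have := IM 1 u v Iu Iv; rewrite mul1r. Qed.

Lemma idealB I u v : is_ideal I -> I u -> I v -> I (u - v).
Proof. by move=> II Iu Iv; rewrite -mulN1r; apply: idealD => //; apply: idealMl. Qed.

Lemma ideal_neqT I : is_ideal I -> (I <> setT) <-> ~ I 1.
Proof.
move=> II; split=> [IT I1|I1 IT]; last by apply: I1; rewrite IT.
apply: IT; apply/seteqP; split=> // x _.
by rewrite -[x]mulr1; exact: idealMl.
Qed.

Lemma proper_idealN1 I : is_proper_ideal I -> ~ I 1.
Proof. by move=> [II /(ideal_neqT II)]. Qed.

(** If [x] is not in [M], the ideal [I] generated by [M] and [x] contains 1 by maximality;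
    multiplying [m + a * x = 1] by [y] puts [y] in [M]. *)
Lemma maximal_ideal_prime M x y :
  maximal_ideal M -> M (x * y) -> M x \/ M y.
Proof.
move=> [[MI _] Mmax] Mxy; have [Mx|NMx] := pselect (M x); [by left|right].
pose I := [set m + a * x | m in M & a in [set: A]].
have II : is_ideal I.
  split; first by exists 0; [exact: (proj1 MI)|exists 0; rewrite // mul0r addr0].
  move=> a _ _ [m Mm [b _ <-]] [n Mn [c _ <-]].
  exists (a * m + n); first exact: (proj2 MI).
  by exists (a * b + c) => //; rewrite mulrDr mulrDl mulrA addrACA.
have Ix : I x by exists 0; [exact: (proj1 MI)|exists 1; rewrite // mul1r add0r].
have MsubI : M `<=` I.
  by move=> m Mm; exists m => //; exists 0; rewrite // mul0r addr0.
have [[m Mm [a _ max1]]|I1] := pselect (I 1).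
  rewrite -[y]mul1r -max1 mulrDl -mulrA; apply: idealD => //.
    by rewrite mulrC; exact: idealMl.
  exact: idealMl.
have IM : I = M by apply: Mmax => //; split=> //; apply/ideal_neqT.
by case: NMx; rewrite -IM.
Qed.

End IdealTheory.

Section Morphism.
Variables (A B : comNzRingType) (g : {rmorphism A -> B}).

Lemma is_ideal_preimage (I : set B) : is_ideal I -> is_ideal (g @^-1` I).
Proof.
move=> [I0 IM]; split=> /=; first by rewrite rmorph0.
by move=> a u v Iu Iv; rewrite rmorphD rmorphM; exact: IM.
Qed.

Lemma is_proper_ideal_preimage (I : set B) :
  is_proper_ideal I -> is_proper_ideal (g @^-1` I).
Proof.
move=> Ip; have gI := is_ideal_preimage (proj1 Ip); split=> //.
by apply/(ideal_neqT gI); rewrite /= rmorph1; exact: proper_idealN1.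
Qed.

Hypothesis gsurj : forall y, exists x, g x = y.

Lemma is_ideal_image (I : set A) : is_ideal I -> is_ideal (g @` I).
Proof.
move=> [I0 IM]; split; first by exists 0; rewrite ?rmorph0.
move=> b _ _ [u Iu <-] [v Iv <-]; have [a <-] := gsurj b.
by exists (a * u + v); [exact: IM|rewrite rmorphD rmorphM].
Qed.

(** If [g u = 1] with [u] in [I], then [1 - u] lies in the kernel, hence in [I], and so does 1. *)
Lemma is_proper_ideal_image (I : set A) :
  is_proper_ideal I -> g @^-1` [set 0] `<=` I -> is_proper_ideal (g @` I).
Proof.
move=> Ip kerI; have gI := is_ideal_image (proj1 Ip); split=> //.
apply/(ideal_neqT gI) => -[u Iu gu1]; apply: (proper_idealN1 Ip).
rewrite -[1](subrK u); apply: idealD (proj1 Ip) _ Iu; apply: kerI.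
by rewrite /= rmorphB gu1 rmorph1 subrr.
Qed.

Lemma maximal_ideal_preimage (M : set B) :
  maximal_ideal M -> maximal_ideal (g @^-1` M).
Proof.
move=> [Mp Mmax]; split; first exact: is_proper_ideal_preimage.
move=> I Ip gMI; have MI : M `<=` g @` I.
  by move=> y My; have [x gx] := gsurj y; exists x => //; apply: gMI; rewrite /= gx.
have kerI : g @^-1` [set 0] `<=` I.
  by move=> x gx0; apply: gMI; rewrite /= gx0; exact: (proj1 (proj1 Mp)).
have gIM := Mmax _ (is_proper_ideal_image Ip kerI) MI.
by apply/seteqP; split=> // x Ix; rewrite /= -gIM; exists x.
Qed.

Lemma maximal_ideal_image (M : set A) :
  maximal_ideal M -> g @^-1` [set 0] `<=` M -> maximal_ideal (g @` M).
Proof.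
move=> [Mp Mmax] kerM; split; first exact: is_proper_ideal_image.
move=> I Ip gMI; have <- : g @^-1` I = M.
  apply: Mmax; first exact: is_proper_ideal_preimage.
  by move=> x Mx; apply: gMI; exists x.
rewrite image_preimage //; apply/seteqP; split=> // y _.
by have [x <-] := gsurj y; exists x.
Qed.

Lemma jacobson_surj x : jacobson A x -> jacobson B (g x).
Proof. by move=> Jx M /maximal_ideal_preimage; exact: Jx. Qed.

(** A partial converse of [jacobson_surj]: the image of [M] is maximal, so [g x = g y] for some [y]
    in [M], and [x - y] is in the kernel. *)
Lemma jacobson_maximal_ker (M : set A) x : maximal_ideal M ->
  g @^-1` [set 0] `<=` M -> jacobson B (g x) -> M x.
Proof.
move=> Mmax kerM Jgx; have [y My gyx] := Jgx _ (maximal_ideal_image Mmax kerM).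
rewrite -[x](subrK y); apply: idealD (proj1 (proj1 Mmax)) _ My; apply: kerM.
by rewrite /= rmorphB gyx subrr.
Qed.

End Morphism.

Lemma jacobson_subdirect (A B C : comNzRingType)
    (p : {rmorphism A -> B}) (q : {rmorphism A -> C}) :
  (forall y, exists x, p x = y) -> (forall y, exists x, q x = y) ->
  (forall x, p x = 0 -> q x = 0 -> x = 0) ->
  forall x, jacobson B (p x) -> jacobson C (q x) -> jacobson A x.
Proof.
move=> psurj qsurj pq0 x Jpx Jqx M Mmax.
have [kerp|] := pselect (p @^-1` [set 0] `<=` M).
  exact: (jacobson_maximal_ker psurj Mmax kerp Jpx).
(* Fix [u] in the kernel of [p] but outside [M]. Any [v] killed by [q] satisfies [u * v = 0], so
   primeness forces the kernel of [q] into [M]. *)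
move=> /existsNP[u /not_implyP[/= pu0 NMu]].
apply: (jacobson_maximal_ker qsurj Mmax _ Jqx) => v /= qv0.
have : M (u * v).
  rewrite (_ : u * v = 0); first exact: (proj1 (proj1 (proj1 Mmax))).
  by apply: pq0; rewrite rmorphM ?pu0 ?mul0r ?qv0 ?mulr0.
by move=> /(maximal_ideal_prime Mmax)[].
Qed.

Section Projections.
Variables (R S : comNzRingType) (f : {rmorphism R -> S}) (J : ideal S).

(** Both projections are composites of ring morphisms, from which their morphism structure is
    inferred. *)
Definition amalg_fst : amalg f J -> R := fst \o val.
Definition amalg_snd : amalg f J -> S := snd \o val.

HB.instance Definition _ := GRing.RMorphism.on amalg_fst.
HB.instance Definition _ := GRing.RMorphism.on amalg_snd.

Lemma amalg_mem a j : (J : set S) j -> (a, f a + j) \in amalg_pred f J.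
Proof. by move=> Jj; apply/mem_set; exists a => //; exists j. Qed.

Definition mk_amalg a j (Jj : (J : set S) j) : amalg f J := Amalg (amalg_mem a Jj).

Lemma amalgP (x : amalg f J) : exists a j (Jj : (J : set S) j), x = mk_amalg a Jj.
Proof.
have /set_mem[a _ [j Jj axj]] := amalg_valP x.
by exists a, j, Jj; apply/val_inj.
Qed.

Lemma amalg_inj (x y : amalg f J) :
  amalg_fst x = amalg_fst y -> amalg_snd x = amalg_snd y -> x = y.
Proof.
move=> xy1 xy2; apply/val_inj.
by rewrite [LHS]surjective_pairing [RHS]surjective_pairing; congr pair.
Qed.

Lemma amalg_fst_surj a : exists x, amalg_fst x = a.
Proof. by exists (mk_amalg a (proj1 (idealP J))). Qed.

Lemma amalg_snd_surj : (forall y, exists a, f a = y) ->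
  forall y, exists x, amalg_snd x = y.
Proof.
move=> fsurj y; have [a <-] := fsurj y.
by exists (mk_amalg a (proj1 (idealP J))); rewrite /amalg_snd /= addr0.
Qed.

Lemma ideal_barE (K : set S) : ideal_bar f J K = amalg_snd @^-1` K.
Proof.
apply/seteqP; split=> [x [a [j [_ Kaj xE]]]|x].
  by rewrite /= /amalg_snd /= xE.
by have [a [j [Jj ->]]] := amalgP x; exists a, j.
Qed.

Lemma jacobson_amalg (fsurj : forall y, exists a, f a = y) (x : amalg f J) :
  maximal_ideal J -> f @` jacobson R = J -> f @^-1` [set 0] `<=` jacobson R ->
  jacobson S (amalg_snd x) -> jacobson (amalg f J) x.
Proof.
move=> Jmax fJ kerf Jx2; apply: (jacobson_subdirect amalg_fst_surj _ _ _ Jx2).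
- exact: amalg_snd_surj.
- by move=> y y1 y2; apply: amalg_inj; rewrite ?y1 ?y2 rmorph0.
(* It remains to see that the first coordinate [a] is in the radical: [f a] lies in [J], so
   [f a = f b] with [b] in [jacobson R], and [a - b] is in the kernel of [f]. *)
have [a [j [Jj xE]]] := amalgP x.
have Jaj : (J : set S) (f a + j) by have := Jx2 _ Jmax; rewrite xE.
have : (J : set S) (f a) by rewrite -[f a](addrK j); exact: idealB (idealP J) Jaj Jj.
rewrite xE -fJ => -[b Jb fba] M Mmax; rewrite -[X in M X](subrK b).
apply: idealD (proj1 (proj1 Mmax)) _ (Jb _ Mmax); apply: kerf Mmax.
by rewrite /= rmorphB fba subrr.
Qed.

End Projections.

Lemma maximal_addl_jacobson (A : comNzRingType) (M : set A) :
  maximal_ideal M -> [set x + y | x in jacobson A & y in M] = M.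
Proof.
move=> Mmax; have MI := proj1 (proj1 Mmax); apply/seteqP; split.
  by move=> _ [x Jx [y My <-]]; exact: idealD MI (Jx _ Mmax) My.
move=> y My; exists 0; last by exists y; rewrite ?add0r.
by move=> N [[[N0 _] _] _].
Qed.

Theorem theorem7 (R S : comNzRingType) (f : {rmorphism R -> S})
    (fsurj : forall y : S, exists x : R, f x = y)
    (J : ideal S) (Jmax : maximal_ideal J)
    (K : set S) (Kideal : is_ideal K) :
  (* (1) *)
  ((J_ideal (ideal_bar f J K) -> J_ideal K) /\
   (f @` jacobson R = [set x + y | x in jacobson S & y in (J : set S)] ->
    f @^-1` [set 0] `<=` jacobson R ->
    J_ideal K -> J_ideal (ideal_bar f J K))) /\
  (* (2) *)
  ((weakly_J_ideal (ideal_bar f J K) ->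
    weakly_J_ideal K /\
    (forall (a b : R) (j k : S), (J : set S) j -> (J : set S) k ->
       ~ jacobson S (f a + j) -> ~ K (f b + k) ->
       (f a + j) * (f b + k) = 0 -> a * b = 0)) /\
   (f @` jacobson R = [set x + y | x in jacobson S & y in (J : set S)] ->
    f @^-1` [set 0] `<=` jacobson R ->
    weakly_J_ideal K ->
    (forall (a b : R) (j k : S), (J : set S) j -> (J : set S) k ->
       ~ jacobson S (f a + j) -> ~ K (f b + k) ->
       (f a + j) * (f b + k) = 0 -> a * b = 0) ->
    weakly_J_ideal (ideal_bar f J K))).
Proof.
have sndsurj := amalg_snd_surj J fsurj.
have barp : is_proper_ideal K <-> is_proper_ideal (ideal_bar f J K).
  rewrite ideal_barE; split; first exact: is_proper_ideal_preimage.
  move=> /proper_idealN1; rewrite /= rmorph1 => K1; split=> //.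
  exact/ideal_neqT.
(* Lets both direct implications lift elements of [S] to the amalgamation. *)
have sndJN x : ~ jacobson S (amalg_snd x) -> ~ jacobson (amalg f J) x.
  by apply: contra_not; exact: jacobson_surj.
rewrite maximal_addl_jacobson //; split; split.
- move=> [/barp Kp barJ]; split=> // x y.
  have [u <-] := sndsurj x; have [v <-] := sndsurj y.
  move=> Kuv /sndJN Ju; move: barJ; rewrite ideal_barE => /(_ u v); exact.
- move=> fJ kerf [/barp Kp KJ]; split=> //; rewrite ideal_barE => u v /=.
  rewrite rmorphM => Kuv Ju; apply: KJ Kuv _.
  by apply: contra_not Ju; exact: jacobson_amalg.
- move=> [/barp Kp]; rewrite ideal_barE => barJ; split.
    split=> // x y; have [u <-] := sndsurj x; have [v <-] := sndsurj y.
    rewrite -rmorphM => uv0 Kuv /sndJN Ju; apply: (barJ u v) => //.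
    by apply: contra_not uv0 => ->; rewrite rmorph0.
  (* Were [a * b] nonzero, the elements [(a, f a + j)] and [(b, f b + k)] would have the nonzero
     product [(a * b, 0)] over [K], forcing [f b + k] into [K]. *)
  move=> a b j k Jj Jk JNaj KNbk ajbk0; apply: contrapT => ab0.
  apply: KNbk; apply: (barJ (mk_amalg f a Jj) (mk_amalg f b Jk)).
  + by move=> /(congr1 (@amalg_fst _ _ f J)); rewrite rmorphM rmorph0.
  + by rewrite /= rmorphM [X in K X]ajbk0; exact: (proj1 Kideal).
  + exact: sndJN.
- move=> fJ kerf [/barp Kp KJ] ann; split=> //; rewrite ideal_barE => u v /=.
  rewrite rmorphM => uv0 Kuv Ju.
  have {}Ju : ~ jacobson S (amalg_snd u).
    by apply: contra_not Ju; exact: jacobson_amalg.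
  (* A nonzero [u * v] may have zero second coordinate, where the weak condition on [K] is silent;
     there [ann] kills the first coordinate too, a contradiction. *)
  have [s0|/KJ] := pselect (amalg_snd u * amalg_snd v = 0); last exact.
  apply: contrapT => KNv; apply: uv0; apply: amalg_inj; rewrite rmorphM rmorph0 //.
  have [a [j [Jj uE]]] := amalgP u; have [b [k [Jk vE]]] := amalgP v.
  by rewrite {}uE {}vE in Ju s0 KNv *; exact: ann Jj Jk Ju KNv s0.
Qed.
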